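(* Let $\mathfrak{g}$ be a finite-dimensional complex Lie algebra and $\mathfrak{a}$ an abelian ideal of $\mathfrak{g}$. For $\ell\in\mathfrak{g}^*$ let $\ell_0=\ell_{|\mathfrak{a}}$, and let $\Omega$ be the set of $\ell\in\mathfrak{g}^*$ such that $\operatorname{codim}_{\mathfrak{a}^*}(\mathfrak{g}.\ell_0)=\operatorname{ind}(\mathfrak{g},\mathfrak{a})$. The following assertions are equivalent: (1) $\operatorname{ind}(\mathfrak{g})+\dim\mathfrak{a}=\dim(\mathfrak{g}/\mathfrak{a})+2\operatorname{ind}(\mathfrak{g},\mathfrak{a})$. (2) For every $\ell\in\Omega$, $\dim(\mathfrak{g}.\ell)=2\dim(\mathfrak{g}.\ell_0)$.
   Context: For $\ell\in\mathfrak{g}^*$, $\mathfrak{g}^\ell=\{x\in\mathfrak{g}:\langle\ell,[x,y]\rangle=0\text{ for all }y\in\mathfrak{g}\}$, and the index of $\mathfrak{g}$ is $\operatorname{ind}(\mathfrak{g})=\min_{\ell\in\mathfrak{g}^*}\dim\mathfrak{g}^\ell$. $\mathfrak{g}$ acts on $\mathfrak{g}^*$ by the coadjoint action $\langle x.\ell,y\rangle=-\langle\ell,[x,y]\rangle$ and on $\mathfrak{a}^*$ by $\langle x.f,a\rangle=-\langle f,[x,a]\rangle$. Put $\mathfrak{g}.\ell=\{x.\ell:x\in\mathfrak{g}\}\subset\mathfrak{g}^*$ and, for $f\in\mathfrak{a}^*$, $\mathfrak{g}.f=\{x.f:x\in\mathfrak{g}\}\subset\mathfrak{a}^*$. Finally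 $\operatorname{ind}(\mathfrak{g},\mathfrak{a})=\min_{f\in\mathfrak{a}^*}\operatorname{codim}_{\mathfrak{a}^*}(\mathfrak{g}.f)$. *)

(* Defs.v *)
From HB Require Import structures.
From mathcomp Require Import all_boot all_order all_algebra.
From mathcomp Require Import boolp classical_sets reals complex.

Set Implicit Arguments.
Unset Strict Implicit.
Unset Printing Implicit Defensive.

Import GRing.Theory.
Local Open Scope ring_scope.

(* Finite-dimensional Lie algebras: [vectType] is finite-dimensional. *)
HB.mixin Record Vector_isLieAlgebra (K : fieldType) L of Vector K L := {
  lie : L -> L -> L;
  lie_linearl : forall y, linear (fun x => lie x y);
  lie_linearr : forall x, linear (lie x);
  lie_alt : forall x, lie x x = 0;
  lie_jacobi : forall x y z,
    lie x (lie y z) + lie y (lie z x) + lie z (lie x y) = 0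
}.

#[short(type="lieAlgType")]
HB.structure Definition LieAlgebra (K : fieldType) :=
  { L of Vector_isLieAlgebra K L & Vector K L }.

(* Minimum over a possibly infinite family of natural numbers; [t0] only
   witnesses that the family is nonempty, see [min_natP]. *)
Section MinNat.
Variables (T : Type) (t0 : T) (F : T -> nat).

Fact min_nat_ex : exists n, `[< exists t, F t = n >].
Proof. by exists (F t0); apply/asboolP; exists t0. Qed.

Definition min_nat : nat := ex_minn min_nat_ex.

Lemma min_natP : (exists t, F t = min_nat) /\ (forall t, (min_nat <= F t)%N).
Proof.
rewrite /min_nat; case: ex_minnP => m /asboolP Fm le_m; split=> // t.
by apply: le_m; apply/asboolP; exists t.
Qed.
End MinNat.

(* codim of U in the ambient space, i.e. the dimension of the quotient by U *)
Definition codim (K : fieldType) (V : vectType K) (U : {vspace V}) : nat :=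
  (\dim {:V} - \dim U)%N.

Lemma linfunE (K : fieldType) (U V : vectType K) (h : U -> V) :
  linear h -> linfun h =1 h.
Proof.
move=> h_lin u.
pose H := GRing.isLinear.Build K U V _ h h_lin.
pose hL : {linear U -> V} := HB.pack h H.
exact: (lfunE hL u).
Qed.

Lemma mem_limgP (K : fieldType) (V W : vectType K) (h : V -> W) w : linear h ->
  reflect (exists x, w = h x) (w \in limg (linfun h)).
Proof.
move=> h_lin; apply: (iffP memv_imgP) => [[x _ ->]|[x ->]]; exists x;
  by rewrite ?memvf ?linfunE.
Qed.

Section LieTheory.
Variables (K : fieldType) (g : lieAlgType K).
Implicit Types (x y : g) (a : {vspace g}) (l m : 'Hom(g, K^o)).

Definition abelian_ideal a : Prop :=
  (forall x y, y \in a -> lie x y \in a) /\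
  {in a &, forall x y, lie x y = 0}.

Definition coad x (l : 'Hom(g, K^o)) : 'Hom(g, K^o) :=
  linfun (fun y => - l (lie x y) : K^o).

(* When a is an ideal, [lie x (vsval u)] lies in a, so that [vsproj a] only
   recasts it as an element of a, see [coad_onE]. *)
Definition coad_on a x (f : 'Hom(subvs_of a, K^o)) : 'Hom(subvs_of a, K^o) :=
  linfun (fun u => - f (vsproj a (lie x (vsval u))) : K^o).

Definition coad_orbit (l : 'Hom(g, K^o)) : {vspace 'Hom(g, K^o)} :=
  limg (linfun (fun x => coad x l)).

Definition coad_orbit_on a (f : 'Hom(subvs_of a, K^o)) :
    {vspace 'Hom(subvs_of a, K^o)} :=
  limg (linfun (fun x => coad_on x f)).

Definition stab (l : 'Hom(g, K^o)) : {vspace g} :=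
  lker (linfun (fun x => linfun (fun y => l (lie x y)) : 'Hom(g, K^o))).

Definition lie_index : nat :=
  min_nat (0 : 'Hom(g, K^o)) (fun l => \dim (stab l)).

Definition rel_index a : nat :=
  min_nat (0 : 'Hom(subvs_of a, K^o)) (fun f => codim (coad_orbit_on f)).

Definition restr a (l : 'Hom(g, K^o)) : 'Hom(subvs_of a, K^o) :=
  linfun (fun u => l (vsval u)).

Definition Omega a : set 'Hom(g, K^o) :=
  [set l | codim (coad_orbit_on (restr a l)) = rel_index a].

(* The functions wrapped in [linfun] above are linear, so these definitions
   compute and the subspaces are the intended sets. *)

Lemma stab_linear_in l x : linear (fun y => l (lie x y) : K^o).
Proof. by move=> k y z; rewrite lie_linearr linearP. Qed.

Lemma coad_linear_in (l : 'Hom(g, K^o)) x :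
  linear (fun y => - l (lie x y) : K^o).
Proof. by move=> k y z; rewrite lie_linearr linearP opprD scalerN. Qed.

Lemma coadE x (l : 'Hom(g, K^o)) y : coad x l y = - l (lie x y).
Proof. exact: (linfunE (coad_linear_in l x)). Qed.

Lemma coad_on_linear_in a (f : 'Hom(subvs_of a, K^o)) x :
  linear (fun u : subvs_of a => - f (vsproj a (lie x (vsval u))) : K^o).
Proof. by move=> k u v; rewrite linearP lie_linearr !linearP. Qed.

Lemma coad_on_projE a x (f : 'Hom(subvs_of a, K^o)) u :
  coad_on x f u = - f (vsproj a (lie x (vsval u))).
Proof. exact: (linfunE (coad_on_linear_in f x)). Qed.

Lemma coad_onE a x (f : 'Hom(subvs_of a, K^o)) u v :
  vsval v = lie x (vsval u) -> coad_on x f u = - f v.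
Proof. by move=> Dv; rewrite coad_on_projE -Dv vsvalK. Qed.

Lemma restrE a l u : restr a l u = l (vsval u).
Proof.
apply: (linfunE (h := fun u : subvs_of a => l (vsval u))) => k v w.
by rewrite !linearP.
Qed.

Lemma coad_linear l : linear (fun x => coad x l).
Proof.
move=> k x y; apply/lfunP => z; rewrite !lfunE /= !lfunE /= !coadE.
by rewrite lie_linearl linearP opprD scalerN.
Qed.

Lemma coad_on_linear a (f : 'Hom(subvs_of a, K^o)) :
  linear (fun x => coad_on x f).
Proof.
move=> k x y; apply/lfunP => z; rewrite !lfunE /= !lfunE /= !coad_on_projE.
by rewrite lie_linearl !linearP.
Qed.

Lemma coad_orbitP l m : reflect (exists x, m = coad x l) (m \in coad_orbit l).
Proof. exact/mem_limgP/coad_linear. Qed.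

Lemma coad_orbit_onP a (f m : 'Hom(subvs_of a, K^o)) :
  reflect (exists x, m = coad_on x f) (m \in coad_orbit_on f).
Proof. exact/mem_limgP/coad_on_linear. Qed.

Lemma stabP l x : reflect (forall y, l (lie x y) = 0) (x \in stab l).
Proof.
have E u v : (linfun (fun y => l (lie u y)) : 'Hom(g, K^o)) v = l (lie u v).
  exact: (linfunE (stab_linear_in l u)).
have lin : linear (fun u => linfun (fun y => l (lie u y)) : 'Hom(g, K^o)).
  move=> k u v; apply/lfunP => z; rewrite !lfunE /= !lfunE /= !E.
  by rewrite lie_linearl linearP.
rewrite memv_ker (linfunE lin); apply: (iffP eqP) => [l0 y|l0].
  by rewrite -E l0 lfunE.
by apply/lfunP => y; rewrite E l0 lfunE.
Qed.

End LieTheory.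

Arguments lie_index {K} g.

(* Main.v *)
(** For [l] with restriction [l0] to [a], restriction maps [g.l] onto [g.l0] and
    kills [a.l] because [a] is abelian; the pairing [(x, u) |-> l [x, u]] on
    [g * a] gives [dim (a.l) = dim (g.l0)], so [dim (g.l) >= 2 dim (g.l0)] for
    every [l].  Assertion (1) says that [2 dim (g.l0)], for [l] in [Omega], is the
    largest dimension of a coadjoint orbit, hence (1) implies (2).  Conversely,
    ranks are lower semicontinuous, so a line joining a form with maximal orbit to
    a point of [Omega] contains a form with both properties. *)
Require Import Defs.
From mathcomp Require Import all_boot all_order all_algebra.
From mathcomp Require Import boolp classical_sets reals complex.
From mathcomp Require Import zify.

Local Open Scope ring_scope.

Set Implicit Arguments.
Unset Strict Implicit.
Unset Printing Implicit Defensive.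

Import GRing.Theory Num.Theory VectorInternalTheory.

(** * Linear algebra: ranks along a line and ranks of a pairing *)

Lemma exists_nonroot (K : numFieldType) (p : {poly K}) :
  p != 0 -> exists t, p.[t] != 0.
Proof.
(* In characteristic zero these naturals are distinct, and there is one more of them than the degree
   of [p]. *)
move=> p0; pose s : seq K := [seq i%:R | i <- iota 0 (size p)].
have /allPn[t _ pt] : ~~ all (root p) s.
  apply/negP => sp.
  have us : uniq s.
    rewrite map_inj_uniq ?iota_uniq // => i j /eqP.
    by rewrite eqr_nat => /eqP.
  by have := max_poly_roots p0 sp us; rewrite size_map size_iota ltnn.
by exists t.
Qed.

(** A full-rank factorization of [C = A + t0 B] gives [L], [M] with [L C M = 1] of size [rank C].
    The polynomial is [det (L (A + t B) M)]: it is 1 at [t0], and wherever it is nonzero the rank is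
    at least [rank C]. *)
Lemma mxrank_pencil_semicontinuous (K : fieldType) m n (A B : 'M[K]_(m, n)) t0 :
  exists2 p : {poly K}, p.[t0] != 0 &
    forall t, p.[t] != 0 -> (\rank (A + t0 *: B)%R <= \rank (A + t *: B)%R)%N.
Proof.
set C := A + t0 *: B.
pose L := pinvmx (col_base C); pose M := pinvmx (row_base C).
have LCM : L *m C *m M = 1%:M.
  have -> : L *m C = row_base C.
    by rewrite -[X in L *m X]mulmx_base mulmxA mulVpmx ?col_base_full // mul1mx.
  by rewrite mulmxVp ?row_base_free.
pose p := \det (map_mx polyC (L *m A *m M) + 'X *: map_mx polyC (L *m B *m M)).
have pE t : p.[t] = \det (L *m (A + t *: B) *m M).
  rewrite -horner_evalE -det_map_mx; congr (\det _); apply/matrixP => i j.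
  rewrite mulmxDr mulmxDl -scalemxAr -scalemxAl !mxE /= horner_evalE.
  by rewrite hornerD hornerC mulrC hornerMX hornerC mulrC.
exists p => [|t]; first by rewrite pE LCM det1 oner_neq0.
rewrite pE -unitfE -unitmxE -row_free_unit => /eqP rk.
apply: (@leq_trans (\rank (L *m (A + t *: B) *m M))); first by rewrite rk.
exact: leq_trans (mxrankM_maxl _ _) (mxrankM_maxr _ _).
Qed.

Lemma dim_limg (K : fieldType) (U V : vectType K) (f : 'Hom(U, V)) :
  \dim (limg f) = \rank (f2mx f).
Proof.
rewrite unlock /dimv genmxE.
have : row_full (vs2mx {:U}) by rewrite /row_full -[\rank _]/(\dim {:U}) dimvf.
by move=> /eqmxMfull ->.
Qed.

Lemma f2mx_linear (K : fieldType) (U V : vectType K) :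
  linear (f2mx : 'Hom(U, V) -> 'M[K]_(dim U, dim V)).
Proof.
have f2mxE (f : 'Hom(U, V)) u : u *m f2mx f = v2r (f (r2v u)).
  by rewrite unlock /= !r2vK.
move=> k f h; apply/row_matrixP => i.
by rewrite linearP /= !rowE !f2mxE !lfunE /= lfunE linearP.
Qed.

Lemma dim_limg_pencil_semicontinuous (K : fieldType) (U V : vectType K)
    (f h : 'Hom(U, V)) t0 :
  exists2 p : {poly K}, p.[t0] != 0 &
    forall t, p.[t] != 0 ->
      (\dim (limg (f + t0 *: h)%R) <= \dim (limg (f + t *: h)%R))%N.
Proof.
have [p p0 pP] := mxrank_pencil_semicontinuous (f2mx f) (f2mx h) t0.
by exists p => // t /pP; rewrite !dim_limg ![(f + _)%R]addrC !f2mx_linear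
  ![(_ + f2mx f)%R]addrC.
Qed.

(** Each form [f u] vanishes on [ker f'], hence is determined by its restriction to a complement [C]
    of [ker f']; and [dim C^* = dim C] is the rank of [f']. *)
Lemma dim_limg_pairing_le (K : fieldType) (U V W : vectType K)
    (f : 'Hom(U, 'Hom(V, K^o))) (f' : 'Hom(V, W)) :
  (forall v u, f' v = 0 -> f u v = 0) ->
  (\dim (limg f) <= \dim (limg f'))%N.
Proof.
move=> f'f; set C := ((lker f')^C)%VS.
pose i : 'Hom(subvs_of C, V) := linfun vsval.
pose r : 'Hom('Hom(V, K^o), 'Hom(subvs_of C, K^o)) :=
  linfun (fun h => (h \o i)%VF).
have rE h : r h = (h \o i)%VF.
  by apply: linfunE => k h1 h2; rewrite comp_lfunDl comp_lfunZl.
have r_inj : (limg f :&: lker r = 0)%VS.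
  apply/eqP; rewrite -subv0; apply/subvP => _ /memv_capP[/memv_imgP[u _ ->]].
  rewrite memv_ker rE memv0 => /eqP fi0; apply/eqP/lfunP => v; rewrite lfunE /=.
  have /memv_addP[w + [c cC ->]] : v \in (lker f' + C)%VS.
    by rewrite addv_complf memvf.
  rewrite memv_ker linearD /= => /eqP/f'f ->; rewrite add0r.
  have := congr1 (fun h : 'Hom(subvs_of C, K^o) => h (vsproj C c)) fi0.
  by rewrite /= !lfunE /= lfunE /= vsprojK.
rewrite -(limg_dim_eq r_inj); apply: leq_trans (dimvS (subvf _)) _.
rewrite dimvf /dim /= muln1 -[leqLHS]/(\dim C) /C dimv_compl.
by rewrite -(limg_ker_dim f' fullv) capfv addKn.
Qed.

(** * Dimensions of coadjoint orbits *)

Section CoadjointOrbits.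
Variables (K : fieldType) (g : lieAlgType K).
Implicit Types (l m : 'Hom(g, K^o)) (a : {vspace g}).

Let coad_map l : 'Hom(g, 'Hom(g, K^o)) := linfun (fun x => coad x l).
Let coad_on_map a (f : 'Hom(subvs_of a, K^o)) :
  'Hom(g, 'Hom(subvs_of a, K^o)) := linfun (fun x => coad_on x f).

Let coad_mapE l x : coad_map l x = coad x l.
Proof. exact/linfunE/coad_linear. Qed.

Let coad_on_mapE a (f : 'Hom(subvs_of a, K^o)) x : coad_on_map f x = coad_on x f.
Proof. exact/linfunE/coad_on_linear. Qed.

Lemma lie_anti (x y : g) : lie x y = - lie y x.
Proof.
have lieDl (u v w : g) : lie (u + v) w = lie u w + lie v w.
  by have := lie_linearl w 1 u v; rewrite !scale1r.
have lieDr (u v w : g) : lie w (u + v) = lie w u + lie w v.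
  by have := lie_linearr w 1 u v; rewrite !scale1r.
apply/eqP; rewrite -addr_eq0; apply/eqP.
by have := lie_alt (x + y); rewrite lieDl !lieDr !lie_alt add0r addr0.
Qed.

Lemma dim_stab_orbit l : (\dim (stab l) + \dim (coad_orbit l) = \dim {:g})%N.
Proof.
rewrite -(limg_ker_dim (coad_map l) fullv) capfv; congr (\dim _ + _)%N.
apply/vspaceP => x; rewrite memv_ker coad_mapE.
apply/stabP/eqP => [l0|l0 y].
  by apply/lfunP => y; rewrite coadE l0 oppr0 lfunE.
by apply: oppr_inj; rewrite -coadE l0 lfunE oppr0.
Qed.

Lemma codim_orbit_on a (f : 'Hom(subvs_of a, K^o)) :
  (codim (coad_orbit_on f) + \dim (coad_orbit_on f) = \dim a)%N.
Proof.
rewrite /codim subnK ?dimvS ?subvf //.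
by rewrite dimvf /dim /= muln1.
Qed.

Lemma restr_coad a l x : abelian_ideal a ->
  restr a (coad x l) = coad_on x (restr a l).
Proof.
move=> [id_a _]; apply/lfunP => u; rewrite restrE coadE coad_on_projE restrE.
by rewrite vsprojK // id_a // subvsP.
Qed.

Lemma restr_linear a : linear (restr a : 'Hom(g, K^o) -> _).
Proof.
by move=> k l m; apply/lfunP => u; rewrite restrE !lfunE /= !lfunE /= !restrE.
Qed.

Lemma restr_surj a (f : 'Hom(subvs_of a, K^o)) : exists l, restr a l = f.
Proof.
exists (f \o linfun (vsproj a))%VF; apply/lfunP => u.
by rewrite restrE !lfunE /= lfunE /= vsvalK.
Qed.

Lemma dim_orbit_ge a l : abelian_ideal a ->
  (2 * \dim (coad_orbit_on (restr a l)) <= \dim (coad_orbit l))%N.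
Proof.
move=> ha; pose r : 'Hom('Hom(g, K^o), 'Hom(subvs_of a, K^o)) := linfun (restr a).
have rE h : r h = restr a h by exact/linfunE/restr_linear.
have <- : (r @: limg (coad_map l) = coad_orbit_on (restr a l))%VS.
  rewrite -limg_comp; congr (limg _); apply/lfunP => x.
  by rewrite lfunE /= rE coad_mapE restr_coad // coad_on_mapE.
have := limg_ker_dim r (limg (coad_map l)).
(* Rank-nullity for [r] on [g.l], whose image is [g.l0]: it remains to bound the dimension of the
   kernel from below by [dim (g.l0)], which is done through [a.l]. *)
rewrite -[in RHS]/(coad_orbit l) => <-; rewrite mul2n -addnn leq_add2r.
pose i : 'Hom(subvs_of a, g) := linfun vsval.
have iE u : i u = vsval u by rewrite lfunE.
apply: (@leq_trans (\dim (limg (coad_map l \o i)))).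
  (* If [u.l = 0] with [u] in [a], then [x.l] vanishes at [u] by antisymmetry of the bracket. *)
  rewrite -limg_comp; apply: dim_limg_pairing_le => u x.
  rewrite !lfunE /= iE rE coad_mapE => u0.
  by rewrite coad_mapE restrE coadE lie_anti linearN -coadE u0 lfunE /= oppr0.
apply/dimvS/subvP => _ /memv_imgP[u _ ->].
rewrite lfunE /= memv_cap memv_img ?memvf //= memv_ker rE iE coad_mapE.
apply/eqP/lfunP => v; rewrite restrE coadE ha.2 ?subvsP //.
by rewrite linear0 oppr0 lfunE.
Qed.

(** The map [x |-> x.l] depends linearly on [l], so a line of forms yields a pencil of linear maps;
    the same holds for forms on [a]. *)
Lemma coad_pencil_semicontinuous l m t0 :
  exists2 p : {poly K}, p.[t0] != 0 & forall t, p.[t] != 0 ->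
    (\dim (coad_orbit (l + t0 *: m)%R) <= \dim (coad_orbit (l + t *: m)%R))%N.
Proof.
have E t : coad_orbit (l + t *: m)%R = limg (coad_map l + t *: coad_map m).
  congr (limg _); apply/lfunP => x; apply/lfunP => y.
  rewrite coad_mapE !lfunE /= !lfunE /= !coad_mapE.
  by rewrite !coadE !lfunE /= !lfunE /= opprD scalerN.
have [p p0 pP] := dim_limg_pencil_semicontinuous (coad_map l) (coad_map m) t0.
by exists p => // t /pP; rewrite !E.
Qed.

Lemma coad_on_pencil_semicontinuous a (f h : 'Hom(subvs_of a, K^o)) t0 :
  exists2 p : {poly K}, p.[t0] != 0 & forall t, p.[t] != 0 ->
    (\dim (coad_orbit_on (f + t0 *: h)%R) <= \dim (coad_orbit_on (f + t *: h)%R))%N.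
Proof.
have E t : coad_orbit_on (f + t *: h)%R = limg (coad_on_map f + t *: coad_on_map h).
  congr (limg _); apply/lfunP => x; apply/lfunP => y.
  rewrite coad_on_mapE !lfunE /= !lfunE /= !coad_on_mapE.
  by rewrite !coad_on_projE !lfunE /= !lfunE /= opprD scalerN.
have [p p0 pP] := dim_limg_pencil_semicontinuous (coad_on_map f) (coad_on_map h) t0.
by exists p => // t /pP; rewrite !E.
Qed.

End CoadjointOrbits.

Lemma exists_generic_form (K : numFieldType) (g : lieAlgType K) (a : {vspace g}) :
  exists2 l : 'Hom(g, K^o), Omega a l & \dim (stab l) = lie_index g.
Proof.
have [[l1 l1P] l1min] := min_natP (0 : 'Hom(g, K^o)) (fun l => \dim (stab l)).
have [[f fP] fmin] :=
  min_natP (0 : 'Hom(subvs_of a, K^o)) (fun f => codim (coad_orbit_on f)).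
have [l2 l2f] := restr_surj f.
(* The line passes through [l1], of minimal stabilizer, at 0 and through [l2], an extension of the
   optimal [f], at 1. A parameter where neither [p] nor [q] vanishes is generic for both
   conditions. *)
have [p p0 pP] := coad_pencil_semicontinuous l1 (l2 - l1) 0.
have [q q1 qP] :=
  coad_on_pencil_semicontinuous (restr a l1) (f - restr a l1) 1.
have pq0 : p * q != 0.
  rewrite mulf_neq0 //; last by apply: contraNneq q1 => ->; rewrite horner0.
  by apply: contraNneq p0 => ->; rewrite horner0.
have [t] := exists_nonroot pq0.
rewrite hornerM mulf_eq0 negb_or => /andP[/pP + /qP].
rewrite scale0r addr0 scale1r [restr a l1 + (f - _)]addrC subrK.
set l := l1 + t *: (l2 - l1).
have -> : restr a l1 + t *: (f - restr a l1) = restr a l.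
  apply/lfunP => u; rewrite restrE !lfunE /= !lfunE /= -l2f.
  by rewrite !lfunE /= !lfunE /= -!/(restr a _) !restrE.
move=> hl hf; exists l; last first.
  (* An orbit at least as large as that of [l1] means a stabilizer no larger than the minimal
     one. *)
  apply/eqP; rewrite eqn_leq [X in _ && X]l1min andbT /lie_index -l1P.
  by have := dim_stab_orbit l; have := dim_stab_orbit l1; lia.
rewrite /Omega /=; apply/eqP; rewrite eqn_leq [X in _ && X]fmin andbT.
rewrite /rel_index -fP -(leq_add2r (\dim (coad_orbit_on f))) codim_orbit_on.
by rewrite -(codim_orbit_on (restr a l)) leq_add2l.
Qed.

Theorem mainTheorem4 (R : realType) (g : lieAlgType R[i]) (a : {vspace g})
    (ha : abelian_ideal a) :
  (lie_index g + \dim a = codim a + 2 * rel_index a)%N <->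
  (forall l : 'Hom(g, R[i]^o), Omega a l ->
     \dim (coad_orbit l) = (2 * \dim (coad_orbit_on (restr a l)))%N).
Proof.
(* This makes the truncated subtraction in [codim a] exact. *)
have ag : (\dim a <= \dim {:g})%N by rewrite dimvS ?subvf.
have orb_on l : Omega a l ->
    (rel_index a + \dim (coad_orbit_on (restr a l)) = \dim a)%N.
  by move=> <-; exact: codim_orbit_on.
rewrite /codim; split => [ind l /orb_on lO|orb].
  have stab_ge : (lie_index g <= \dim (stab l))%N.
    exact: (min_natP (0 : 'Hom(g, R[i]^o)) (fun l => \dim (stab l))).2.
  (* By (1), [n - i = 2 (d - r) = 2 q], so [2 q <= o = n - s <= n - i = 2 q]. *)
  have arith n d i r s o q : (d <= n -> i + d = n - d + 2 * r -> r + q = d ->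
      i <= s -> s + o = n -> 2 * q <= o -> o = 2 * q)%N by lia.
  exact: arith ag ind lO stab_ge (dim_stab_orbit l) (dim_orbit_ge l ha).
(* For one [l] in [Omega] attaining the index, (2) reads [n - i = 2 (d - r)], which is (1). *)
have [l lO lS] := exists_generic_form a.
have arith n d i r o q : (d <= n -> r + q = d -> i + o = n -> o = 2 * q ->
    i + d = n - d + 2 * r)%N by lia.
apply: arith ag (orb_on l lO) _ (orb l lO).
by rewrite -lS; exact: dim_stab_orbit.
Qed.
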